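(* For every $k \in \mathbb{N}$ and every minimally unsatisfiable clause-set $F$ with $\delta(F) \le k$ and $F \neq \{\bot\}$ we have $\mathrm{minvdeg}(F) \le \mathrm{N}(k)$. More precisely, there exists a variable $v \in \mathrm{var}(F)$ with $\mathrm{vdeg}_F(v) \le \mathrm{N}(k)$ and $\mathrm{ld}_F(v) \le k$, $\mathrm{ld}_F(\overline{v}) \le k$.
   Context: Literals come with a fixed-point-free involution $x \mapsto \overline{x}$ (complementation); variables are the positive literals, and $\mathrm{var}(x)$ is the underlying variable of a literal $x$. A clause is a finite set $C$ of literals with $C \cap \overline{C} = \emptyset$, where $\overline{L} = \{\overline{x} : x \in L\}$; a clause-set is a finite set of clauses. $\bot$ is the empty clause. For a clause-set $F$: $\mathrm{var}(F)$ is the set of variables occurring in $F$, $n(F) = |\mathrm{var}(F)|$, $c(F) = |F|$, and the deficiency is $\delta(F) = c(F) - n(F)$. A partial assignment is a map $\varphi : V \to \{0,1\}$ for a finite set $V$ of variables, extended to literals by $\varphi(\overline{v}) = 1 - \varphi(v)$; $F$ is satisfiable iff there is a partial assignment $\varphi$ such that every clause of $F$ contains a literal $x$ with $\varphi(x) = 1$. $F$ is minimally unsatisfiable if $F$ is unsatisfiable and $F \setminus \{C\}$ is satisfiable for every $C \in F$. The literal degree $\mathrm{ld}_F(x)$ is the number of clauses of $F$ containing $x$; the variable degree is $\mathrm{vdeg}_F(v) = \mathrm{ld}_F(v) + \mathrm{ld}_F(\overline{v})$; $\mathrm{minvdeg}(F) = \min_{v \in \mathrm{var}(F)} \mathrm{vdeg}_F(v)$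 if $n(F) > 0$ and $+\infty$ otherwise. The function $\mathrm{N} : \mathbb{N} \to \mathbb{N}$ (non-Mersenne numbers) is defined recursively by $\mathrm{N}(1) = 2$ and, for $k \ge 2$, $\mathrm{N}(k) = \max_{i \in \{2,\dots,k\}} \min(2i, \mathrm{N}(k-i+1) + i)$. Here $\mathbb{N} = \{1,2,\dots\}$. *)

(* Defs.v *)
From mathcomp Require Import all_boot all_order all_algebra.
From mathcomp Require Import finmap.
Set Implicit Arguments. Unset Strict Implicit. Unset Printing Implicit Defensive.
Local Open Scope fset_scope.

(* Variables are natural numbers; a literal is a pair (v, b):
   (v, true) is the positive literal v, (v, false) is its complement. *)
Definition lit := (nat * bool)%type.
Definition litvar (x : lit) : nat := x.1.
Definition compl (x : lit) : lit := (x.1, ~~ x.2).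

Definition clause := {fset lit}.
Definition clauseset := {fset clause}.

Definition is_clause (C : clause) : Prop := forall x, x \in C -> compl x \notin C.
Definition is_clauseset (F : clauseset) : Prop := forall C, C \in F -> is_clause C.

Definition bot : clause := fset0.

Definition lits (F : clauseset) : {fset lit} := \bigcup_(C <- F) C.
Definition vars (F : clauseset) : {fset nat} := [fset litvar x | x in lits F].
Definition nvar (F : clauseset) : nat := #|` vars F|.
Definition ncl (F : clauseset) : nat := #|` F|.
Definition deficiency (F : clauseset) : int := (ncl F)%:Z - (nvar F)%:Z.

Definition passign := {fmap nat -> bool}.
Definition lit_true (phi : passign) (x : lit) : bool := (phi.[? x.1])%fmap == Some x.2.
Definition satisfies (phi : passign) (F : clauseset) : Prop :=
  forall C, C \in F -> exists2 x, x \in C & lit_true phi x.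
Definition satisfiable (F : clauseset) : Prop := exists phi, satisfies phi F.

Definition min_unsat (F : clauseset) : Prop :=
  ~ satisfiable F /\ forall C, C \in F -> satisfiable (F `\ C).

Definition ld (F : clauseset) (x : lit) : nat := #|` [fset C in F | x \in C]|.
Definition vdeg (F : clauseset) (v : nat) : nat := ld F (v, true) + ld F (v, false).

(* Non-Mersenne numbers: N(1) = 2,
   N(k) = max_{2 <= i <= k} min(2i, N(k-i+1) + i) for k >= 2.
   Implemented with fuel f >= k; N k := Nfuel k k.  (N 0 is not meaningful.) *)
Fixpoint Nfuel (f k : nat) : nat :=
  match f with
  | 0 => 2
  | f'.+1 => if k <= 1 then 2
             else \max_(2 <= i < k.+1) minn (2 * i) (Nfuel f' (k - i + 1) + i)
  end.
Definition Nnm (k : nat) : nat := Nfuel k k.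

(* Main.v *)
(* Literals may be added to the clauses of a minimally unsatisfiable F as long
   as it stays unsatisfiable; this keeps the variables and the number of clauses
   and only increases degrees, so F may be assumed saturated.  Setting a literal
   x then yields again a minimally unsatisfiable F'.  If the variable v of x has
   minimal degree, only v disappears, so F' has deficiency d - ld x + 1 where d is
   that of F.  Induction on the number of variables gives deficiency >= 1, hence
   ld x <= d.  Take x over v of larger degree i; then vdeg v <= 2i.  If i >= 2,
   by induction F' has a variable of degree at most N(k-i+1), which loses at most
   i occurrences from F to F', so vdeg v <= N(k-i+1) + i as v is minimal. *)
Require Import Defs.
From mathcomp Require Import all_boot all_order all_algebra.
From mathcomp Require Import finmap zify.
From Stdlib Require Import Classical.
Local Open Scope fset_scope.
Set Implicit Arguments. Unset Strict Implicit.

(** * Total assignments and complementary literals *)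

Definition tsat (f : nat -> bool) (F : clauseset) : Prop :=
  forall C, C \in F -> exists2 x, x \in C & f x.1 = x.2.

Lemma varsP (F : clauseset) (v : nat) :
  reflect (exists C x, [/\ C \in F, x \in C & x.1 = v]) (v \in vars F).
Proof.
apply: (iffP (imfsetP _ _ _ _)) => /=.
  by move=> [x /bigfcupP [C /andP[CF _] xC] ->]; exists C, x.
by move=> [C [x [CF xC <-]]]; exists x => //; apply/bigfcupP; exists C; rewrite ?CF.
Qed.

(** Unassigned variables get the value false; conversely, a total assignment is restricted to the
    finite set [vars F]. *)
Lemma satisfiableP (F : clauseset) : satisfiable F <-> exists f, tsat f F.
Proof.
split=> [[phi sphi]|[f sf]].
  exists (fun v => phi.[? v]%fmap == Some true) => C /sphi[x xC /eqP phix].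
  by exists x; rewrite // phix; case: x.2.
exists [fmap v : vars F => f (val v)]%fmap => C CF.
have [x xC fx] := sf C CF.
have xF : x.1 \in vars F by apply/varsP; exists C, x.
by exists x; rewrite // /lit_true in_fnd ffunE /= fx.
Qed.

Lemma satisfiable_sub (F G : clauseset) :
  F `<=` G -> satisfiable G -> satisfiable F.
Proof. by move=> /fsubsetP sub [phi s]; exists phi => C /sub /s. Qed.

Definition setlit (x : lit) (f : nat -> bool) (v : nat) : bool :=
  if v == x.1 then x.2 else f v.

Lemma complK (x : lit) : compl (compl x) = x.
Proof. by case: x => v b; rewrite /compl negbK. Qed.

Lemma compl_neq (x : lit) : compl x != x.
Proof. by case: x => v [|]; rewrite xpair_eqE andbF. Qed.

Lemma lit_eqVcompl (x y : lit) : x.1 = y.1 -> x = y \/ x = compl y.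
Proof.
by case: x y => [v [|]] [w [|]] /= ->; rewrite /compl /=; by [left|right].
Qed.

Lemma setlit_neq_compl (x y : lit) (f : nat -> bool) :
  f y.1 = y.2 -> y != compl x -> setlit x f y.1 = y.2.
Proof.
rewrite /setlit; have [/lit_eqVcompl [->|->]|//] := eqVneq y.1 x.1 => //.
by rewrite eqxx.
Qed.

(** * Minimally unsatisfiable clause-sets *)

(** If [D] differed from [C], an assignment satisfying all clauses but [C] would satisfy [D], hence
    its superset [C]. *)
Lemma min_unsat_antichain (F : clauseset) (C D : clause) :
  min_unsat F -> C \in F -> D \in F -> D `<=` C -> C = D.
Proof.
move=> [unsat msat] CF DF /fsubsetP DC.
have [//|neq] := eqVneq C D; case: unsat.
have [phi s] := msat C CF; exists phi => E EF.
have [->|EC] := eqVneq E C; last by apply: s; rewrite !inE EC.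
have [x xD tx] : exists2 x, x \in D & lit_true phi x.
  by apply: s; rewrite !inE eq_sym neq.
by exists x => //; apply: DC.
Qed.

Lemma ldE (F : clauseset) (x : lit) : ld F x = \sum_(C <- F) (x \in C).
Proof. by rewrite /ld card_fset_sum1 big_fset /= big_mkcond. Qed.

Lemma ncl_eq_notin_ld (F : clauseset) (x : lit) :
  ncl F = (\sum_(C <- F | x \notin C) 1 + ld F x)%N.
Proof.
rewrite /ncl card_fset_sum1 ldE (bigID (fun C : clause => x \notin C)) /=.
by congr addn; rewrite -big_mkcond; apply: eq_bigl => C; rewrite negbK.
Qed.

Lemma ld_gt0 (F : clauseset) (x : lit) :
  (0 < ld F x)%N <-> exists2 C, C \in F & x \in C.
Proof.
rewrite /ld cardfs_gt0; split.
  by case/fset0Pn => C; rewrite !inE => /andP[CF xC]; exists C.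
by case=> C CF xC; apply/fset0Pn; exists C; rewrite !inE CF.
Qed.

Lemma min_unsat_ld_gt0 (F : clauseset) (x : lit) :
  min_unsat F -> x.1 \in vars F -> (0 < ld F x)%N.
Proof.
move=> [unsat msat] /varsP[C [y [CF yC /lit_eqVcompl yx]]].
case: yx yC => -> xC; first by apply/ld_gt0; exists C.
rewrite lt0n; apply/negP => /eqP ldx; apply: unsat.
have nox D : D \in F -> x \notin D.
  move=> DF; apply/negP => xD; suff: (0 < ld F x)%N by rewrite ldx.
  by apply/ld_gt0; exists D.
(* [compl x] lies in [C] and [x] occurs nowhere, so making [compl x] true satisfies [C] and harms no
   other clause. *)
have /satisfiableP[f sf] := msat C CF.
apply/satisfiableP; exists (setlit (compl x) f) => D DF.
have [->|DC] := eqVneq D C.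
  by exists (compl x) => //; rewrite /setlit eqxx.
have [z zD fz] : exists2 z, z \in D & f z.1 = z.2 by apply: sf; rewrite !inE DC.
exists z => //; apply: setlit_neq_compl => //; rewrite complK.
by apply: contraNneq (nox D DF) => <-.
Qed.

Lemma vars0_eq_bot (F : clauseset) :
  min_unsat F -> vars F = fset0 -> F = [fset bot].
Proof.
move=> [unsat _] v0.
have Fbot C : C \in F -> C = bot.
  move=> CF; apply/eqP; rewrite -[_ == _]negbK; apply/negP => /fset0Pn [x xC].
  by suff: x.1 \in vars F; [rewrite v0 | apply/varsP; exists C, x].
apply/fsetP => C; rewrite inE; apply/idP/eqP => [/Fbot//|->].
(* Without [bot], [F] would be empty and satisfied vacuously. *)
apply: contraT => nF; case: unsat; apply/satisfiableP; exists xpredT => D DF.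
by rewrite -(Fbot D DF) DF in nF.
Qed.

(** * Saturation *)

Definition extend (F : clauseset) (C : clause) (x : lit) : clauseset :=
  (x |` C) |` (F `\ C).

(** Restricting [x] to variables of [F] keeps [vars F] fixed and lets saturation terminate. *)
Definition saturated (F : clauseset) : Prop :=
  forall C x, C \in F -> x.1 \in vars F -> x \notin C -> compl x \notin C ->
  satisfiable (extend F C x).

Section Extend.
Variables (F : clauseset) (C : clause) (x : lit).
Hypotheses (cF : is_clauseset F) (muF : min_unsat F) (CF : C \in F).
Hypotheses (xF : x.1 \in vars F) (xC : x \notin C) (cxC : compl x \notin C).
Hypothesis unsat_ext : ~ satisfiable (extend F C x).

(** By the antichain property; thus enlarging [C] merges no two clauses. *)
Lemma extend_fresh : x |` C \notin F.
Proof.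
apply/negP => H; have := min_unsat_antichain muF H CF (fsubsetU1 _ _).
by move=> E; move: xC; rewrite -E !inE eqxx.
Qed.

(** Common source of the clause count, the literal degrees and the total size after an extension. *)
Lemma big_extend (G : clause -> nat) :
  (\sum_(D <- extend F C x) G D + G C = \sum_(D <- F) G D + G (x |` C))%N.
Proof.
rewrite /extend big_fsetU1 /=; last first.
  by rewrite !inE negb_and (negPf extend_fresh) orbT.
by rewrite (big_fsetD1 C CF) /=; clear; lia.
Qed.

Lemma extend_is_clauseset : is_clauseset (extend F C x).
Proof.
move=> D; rewrite !inE => /orP[/eqP ->|/andP[_ /cF]] //.
move=> y; rewrite !inE => /orP[/eqP ->|yC]; rewrite negb_or.
  by rewrite cxC andbT compl_neq.
rewrite (cF CF yC) andbT; apply: contraNneq cxC => <-; by rewrite complK.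
Qed.

Lemma extend_min_unsat : min_unsat (extend F C x).
Proof.
split=> // D; rewrite !inE => /orP[/eqP ->|/andP[DC DF]].
  apply: satisfiable_sub (muF.2 C CF); apply/fsubsetP => E.
  by rewrite !inE => /andP[/negPf ->].
(* An assignment satisfying all clauses but [D] satisfies [C], hence also the enlarged clause. *)
have [phi s] := muF.2 D DF; exists phi => E.
rewrite !inE => /andP[ED /orP[/eqP ->|/andP[_ EF]]].
  have [|y yC ty] := s C; first by rewrite !inE eq_sym DC.
  by exists y; rewrite // !inE yC orbT.
by apply: s; rewrite !inE ED.
Qed.

Lemma extend_vars : vars (extend F C x) = vars F.
Proof.
apply/fsetP => v; apply/varsP/varsP => -[D [y [+ yD yv]]].
  rewrite !inE => /orP[/eqP eD|/andP[_ DF]]; last by exists D, y.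
  move: yD; rewrite eD !inE => /orP[/eqP yx|yC]; last by exists C, y.
  by apply/varsP; rewrite -yv yx.
move=> DF; have [eD|DC] := eqVneq D C.
  by exists (x |` C), y; rewrite !inE eqxx -eD yD orbT.
by exists D, y; rewrite !inE DC DF orbT.
Qed.

Lemma extend_ncl : ncl (extend F C x) = ncl F.
Proof. by have := big_extend (fun=> 1%N); rewrite /ncl !card_fset_sum1; clear; lia. Qed.

Lemma extend_ld (y : lit) : (ld F y <= ld (extend F C x) y)%N.
Proof.
have := big_extend (fun D => y \in D); rewrite !ldE !inE.
by case: (y \in C); rewrite ?orbT; clear; lia.
Qed.

Lemma extend_size :
  (\sum_(D <- extend F C x) #|` D| = (\sum_(D <- F) #|` D|).+1)%N.
Proof. by have := big_extend (fun D => #|` D|); rewrite cardfsU1 xC /=; clear; lia. Qed.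

End Extend.

Lemma card_clause_le (F : clauseset) (C : clause) :
  is_clauseset F -> C \in F -> (#|` C| <= nvar F)%N.
Proof.
move=> cF CF.
have inj : {in C &, injective litvar}.
  move=> y z yC zC /lit_eqVcompl [//|yz].
  by move: (cF C CF z zC); rewrite -yz yC.
rewrite -(eqP (introT (card_in_imfsetP litvar C) inj)).
apply: fsubset_leq_card; apply/fsubsetP => v /imfsetP[y /= yC ->].
by apply/varsP; exists C, y.
Qed.

Lemma leq_size_lits (F : clauseset) :
  is_clauseset F -> (\sum_(C <- F) #|` C| <= ncl F * nvar F)%N.
Proof.
move=> cF; rewrite /ncl card_fset_sum1 big_distrl /= !big_seq.
by apply: leq_sum => C CF; rewrite mul1n card_clause_le.
Qed.

Lemma saturate (F : clauseset) :
  is_clauseset F -> min_unsat F ->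
  exists G, [/\ is_clauseset G, min_unsat G & saturated G] /\
    [/\ vars G = vars F, ncl G = ncl F & forall x, (ld F x <= ld G x)%N].
Proof.
(* The measure is the room left for literal occurrences below the bound [ncl F * nvar F]. *)
move: {2}(_.+1) (ltnSn (ncl F * nvar F - \sum_(C <- F) #|` C|)) => m.
elim: m F => // m IH F lt_m cF muF.
have [satF|unsF] := classic (saturated F); first by exists F.
have [C [x [CF xF xC cxC nsat]]] : exists C x, [/\ C \in F, x.1 \in vars F,
    x \notin C, compl x \notin C & ~ satisfiable (extend F C x)]
  by apply: NNPP => H; apply: unsF => C x CF xF xC cxC; apply: NNPP => nsat;
     apply: H; exists C, x.
have ncE := extend_ncl muF CF xC.
have nvE := extend_vars CF xF.
have cE := extend_is_clauseset cF CF cxC.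
(* The bound for the extended set shows that the truncated difference was positive, so it really
   decreases. *)
have := leq_size_lits cE.
rewrite (extend_size muF CF xC) ncE /nvar nvE -/(nvar F) => le_s.
have muE := extend_min_unsat muF CF nsat.
have [|//|//|G [mG [eqv eqc leld]]] := IH (extend F C x).
  by rewrite ncE /nvar nvE -/(nvar F) (extend_size muF CF xC); lia.
exists G; split=> //; split; [by rewrite eqv|by rewrite eqc|] => y.
exact: leq_trans (extend_ld muF CF xC y) (leld y).
Qed.

(** * Splitting on a literal *)

(* The result of setting [x] to true. *)
Definition split (F : clauseset) (x : lit) : clauseset :=
  [fset C `\ compl x | C in F & x \notin C].

Lemma splitP (F : clauseset) (x : lit) (D : clause) :
  reflect (exists C, [/\ C \in F, x \notin C & D = C `\ compl x])
          (D \in split F x).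
Proof.
apply: (iffP (imfsetP _ _ _ _)) => /=.
  by move=> [C /andP[CF xC] ->]; exists C.
by move=> [C [CF xC ->]]; exists C => //; rewrite inE CF.
Qed.

(** If only one clause, or neither, contains [compl x], one clause includes the other and the
    antichain property applies. *)
Lemma split_inj (F : clauseset) (x : lit) (C D : clause) :
  min_unsat F -> C \in F -> D \in F ->
  C `\ compl x = D `\ compl x -> C = D.
Proof.
move=> muF CF DF eCD.
have [cxC|/mem_fsetD1 E] := boolP (compl x \in C); last first.
  by apply/esym/(min_unsat_antichain muF) => //; rewrite -E eCD fsubD1set.
have [cxD|/mem_fsetD1 E] := boolP (compl x \in D).
  by rewrite -(fsetD1K cxC) eCD fsetD1K.
by apply/(min_unsat_antichain muF) => //; rewrite -E -eCD fsubD1set.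
Qed.

Lemma big_split_lit (F : clauseset) (x : lit) (G : clause -> nat) :
  min_unsat F ->
  (\sum_(D <- split F x) G D = \sum_(C <- F | x \notin C) G (C `\ compl x))%N.
Proof.
move=> muF; rewrite big_imfset /= ?big_filter // => C D /andP[CF _] /andP[DF _].
exact: (split_inj muF).
Qed.

Lemma split_ncl (F : clauseset) (x : lit) :
  min_unsat F -> ncl F = (ncl (split F x) + ld F x)%N.
Proof.
by move=> muF; rewrite (ncl_eq_notin_ld _ x) /ncl card_fset_sum1 big_split_lit.
Qed.

Lemma split_is_clauseset (F : clauseset) (x : lit) :
  is_clauseset F -> is_clauseset (split F x).
Proof.
move=> cF D /splitP[C [CF _ ->]] y; rewrite !inE => /andP[_ yC].
by rewrite negb_and (cF C CF y yC) orbT.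
Qed.

Lemma split_min_unsat (F : clauseset) (x : lit) :
  min_unsat F -> saturated F -> x.1 \in vars F -> min_unsat (split F x).
Proof.
move=> muF satF xF; have [unsat msat] := muF; split.
  move=> /satisfiableP[f sf]; apply: unsat; apply/satisfiableP.
  exists (setlit x f) => C CF.
  have [xC|xC] := boolP (x \in C); first by exists x; rewrite // /setlit eqxx.
  have [|y] := sf (C `\ compl x); first by apply/splitP; exists C.
  rewrite !inE => /andP[yx yC] fy; exists y => //; exact: setlit_neq_compl.
move=> D /splitP[C [CF xC ->]].
(* An assignment satisfying [F] without [C] must falsify [C], so it makes [x] true when [compl x] is
   in [C]. Otherwise saturation allows adding [x] to [C], and then only [x] can satisfy the enlarged
   clause. *)
have [f [sf fx]] : exists f, tsat f (F `\ C) /\ f x.1 = x.2.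
  have [cxC|cxC] := boolP (compl x \in C).
    have /satisfiableP[f sf] := msat C CF; exists f; split=> //.
    apply: NNPP => fx; apply: unsat; apply/satisfiableP; exists f => E EF.
    have [->|EC] := eqVneq E C; last by apply: sf; rewrite !inE EC.
    by exists (compl x) => //=; move: fx; case: (f _); case: (x.2).
  have /satisfiableP[f sf] := satF C x CF xF xC cxC; exists f; split.
    by move=> E EF; apply: sf; rewrite inE EF orbT.
  apply: NNPP => fx; apply: unsat; apply/satisfiableP; exists f => E EF.
  have [->|EC] := eqVneq E C; last by apply: sf; rewrite !inE EC EF orbT.
  have [|y] := sf (x |` C); first by rewrite !inE eqxx.
  by rewrite !inE => /orP[/eqP ->|yC] fy; [case: fx | exists y].
apply/satisfiableP; exists f => E; rewrite inE => /andP[EC /splitP[E' [E'F xE' eE]]].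
have E'C : E' != C by apply: contraNneq EC => <-; rewrite eE inE.
have [|y yE' fy] := sf E'; first by rewrite !inE E'C.
exists y => //; rewrite eE !inE yE' andbT; apply: contraPneq fx => yx.
by move: fy; rewrite yx /= => ->; case: (x.2).
Qed.

(** Only clauses containing [x] are lost, and each holds at most one of the two literals over
    [w]. *)
Lemma vdeg_le_split (F : clauseset) (x : lit) (w : nat) :
  is_clauseset F -> min_unsat F -> w != x.1 ->
  (vdeg F w <= vdeg (split F x) w + ld F x)%N.
Proof.
move=> cF muF wx.
have E b : ld (split F x) (w, b) = (\sum_(C <- F | x \notin C) ((w, b) \in C))%N.
  rewrite ldE big_split_lit //; apply: eq_bigr => C _; rewrite !inE.
  by case: eqP => // e; rewrite /compl in e; case: e wx => -> _; rewrite eqxx.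
rewrite /vdeg !E !ldE.
rewrite !(bigID (fun C : clause => x \notin C) xpredT) /=.
have : (\sum_(C <- F | ~~ (x \notin C)) ((w, true) \in C) +
        \sum_(C <- F | ~~ (x \notin C)) ((w, false) \in C) <=
        \sum_(C <- F | ~~ (x \notin C)) (x \in C))%N.
  rewrite -big_split /= big_seq_cond [leqRHS]big_seq_cond; apply: leq_sum => C.
  rewrite negbK => /andP[CF ->].
  have := cF C CF (w, true); rewrite /compl /=.
  by case: (_ \in C) => [/(_ isT)/negPf ->|_] //; case: (_ \in C).
by move=> le_x; rewrite addnACA leq_add2l (leq_trans le_x) // leq_addl.
Qed.

Lemma exists_min_vdeg (F : clauseset) : vars F != fset0 ->
  exists2 v, v \in vars F & forall w, w \in vars F -> (vdeg F v <= vdeg F w)%N.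
Proof.
case/fset0Pn => v0 v0F.
have [i _ imin] := @arg_minnP _ [` v0F] xpredT (fun v => vdeg F (val v)) isT.
by exists (val i) => [|w wF]; [exact: valP | exact: (imin [` wF])].
Qed.

(* A variable vanishing from [split F x] occurs only in clauses containing [x],
   so has smaller degree than the variable of [x]. *)
Lemma split_vars (F : clauseset) (x : lit) :
  is_clauseset F -> min_unsat F -> x.1 \in vars F ->
  (forall w, w \in vars F -> (vdeg F x.1 <= vdeg F w)%N) ->
  vars (split F x) = vars F `\ x.1.
Proof.
move=> cF muF xF xmin; apply/fsetP => w; rewrite !inE; apply/idP/idP.
  case/varsP => D [y [/splitP[C [CF xC ->]]]]; rewrite !inE => /andP[yx yC] <-.
  apply/andP; split; last by apply/varsP; exists C, y.
  apply: contraNneq yx => /lit_eqVcompl [e|->] //; by rewrite -e yC in xC.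
case/andP => wx wF; apply: contraT => nw.
have v0 : vdeg (split F x) w = 0%N.
  rewrite /vdeg; apply/eqP; rewrite addn_eq0 !eqn0Ngt.
  by apply/andP; split; apply: contra nw => /ld_gt0 [C CF wC];
     apply/varsP; eexists C, _; split; eauto.
have := vdeg_le_split cF muF wx; rewrite v0 add0n => le_w.
have := leq_trans (xmin w wF) le_w.
(* This makes [ld F x] strictly smaller than the degree of the variable of [x]. *)
have : (0 < ld F (compl x))%N by apply: min_unsat_ld_gt0.
by case: (x) => v [|]; rewrite /vdeg /compl /=; lia.
Qed.

Lemma split_nvar (F : clauseset) (x : lit) :
  is_clauseset F -> min_unsat F -> x.1 \in vars F ->
  (forall w, w \in vars F -> (vdeg F x.1 <= vdeg F w)%N) ->
  nvar F = (nvar (split F x)).+1.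
Proof.
by move=> cF muF xF xmin; rewrite /nvar split_vars // (cardfsD1 x.1) xF.
Qed.

(** * The deficiency bound and non-Mersenne numbers *)

(** Tarsi's lemma: splitting the saturated set at a variable of minimal degree costs exactly one
    variable and at least one clause. *)
Lemma tarsi (F : clauseset) :
  is_clauseset F -> min_unsat F -> (nvar F < ncl F)%N.
Proof.
move: {2}(nvar F) (leqnn (nvar F)) => n.
elim: n F => [|n IH] F le_n cF muF.
  move: le_n; rewrite leqn0 cardfs_eq0 => /eqP v0.
  by rewrite /nvar v0 cardfs0 (vars0_eq_bot muF v0) /ncl cardfs1.
have [v0|] := eqVneq (vars F) fset0.
  by rewrite /nvar v0 cardfs0 (vars0_eq_bot muF v0) /ncl cardfs1.
have [G [[cG muG satG] [eqv eqc _]]] := saturate cF muF.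
rewrite -eqv => /exists_min_vdeg [v vG vmin].
rewrite -eqc {1}/nvar -eqv -/(nvar G).
pose x : lit := (v, true).
have nG : nvar G = (nvar (split G x)).+1 by apply: split_nvar.
have : (0 < ld G x)%N by apply: min_unsat_ld_gt0.
have : (nvar (split G x) < ncl (split G x))%N.
  apply: IH; [|exact: split_is_clauseset|exact: split_min_unsat].
  by rewrite -ltnS -nG /nvar eqv.
by rewrite (split_ncl x muG) nG; lia.
Qed.

(** The two bounds on [m] bound the minimum at index [i], one term of the maximum. *)
Lemma Nfuel_ge (f k i m : nat) :
  (2 <= i <= k)%N -> (m <= 2 * i)%N -> (m <= Nfuel f (k - i + 1) + i)%N ->
  (m <= Nfuel f.+1 k)%N.
Proof.
move=> ik m1 m2 /=; rewrite ifN; last by lia.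
rewrite (big_cat_nat (n := i)) /=; [|lia|lia].
rewrite (big_cat_nat (n := i.+1) (m := i)) /=; [|lia|lia].
by rewrite big_nat1 !leq_max leq_min m1 m2 orbT.
Qed.

Lemma Nfuel_ge2 (f k : nat) : (2 <= Nfuel f k)%N.
Proof.
case: f k => [|f] [|[|k]] //; by apply: (@Nfuel_ge f _ 2); lia.
Qed.

(** The deficiency drops by [ld F x - 1], written additively to stay in the naturals. *)
Lemma split_deficiency (F : clauseset) (x : lit) :
  is_clauseset F -> min_unsat F -> x.1 \in vars F ->
  (forall w, w \in vars F -> (vdeg F x.1 <= vdeg F w)%N) ->
  (ncl (split F x) + ld F x + nvar F = ncl F + nvar (split F x) + 1)%N.
Proof.
move=> cF muF xF xmin; rewrite (split_nvar cF muF xF xmin) (split_ncl x muF).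
by lia.
Qed.

Lemma min_vdeg_ld_le (F : clauseset) (x : lit) :
  is_clauseset F -> min_unsat F -> saturated F -> x.1 \in vars F ->
  (forall w, w \in vars F -> (vdeg F x.1 <= vdeg F w)%N) ->
  (ld F x + nvar F <= ncl F)%N.
Proof.
move=> cF muF satF xF xmin; have := split_deficiency cF muF xF xmin.
have := tarsi (split_is_clauseset (x := x) cF) (split_min_unsat muF satF xF).
by lia.
Qed.

(** Were the variable of [x] the only one, every clause containing [x] would be the unit clause of
    [x]. *)
Lemma split_vars_neq0 (F : clauseset) (x : lit) :
  is_clauseset F -> min_unsat F -> x.1 \in vars F ->
  (forall w, w \in vars F -> (vdeg F x.1 <= vdeg F w)%N) ->
  (1 < ld F x)%N -> vars (split F x) != fset0.
Proof.
move=> cF muF xF xmin ldx; rewrite split_vars //.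
apply: contraTneq ldx => /eqP; rewrite fsetD_eq0 => /fsubsetP vx.
rewrite -leqNgt -(cardfs1 [fset x]); apply: fsubset_leq_card.
apply/fsubsetP => C; rewrite !inE => /andP[CF xC]; apply/eqP/fsetP => y.
rewrite inE; apply/idP/eqP => [yC|-> //].
have /vx : y.1 \in vars F by apply/varsP; exists C, y.
rewrite inE => /eqP/lit_eqVcompl [//|e].
by have := cF C CF x xC; rewrite -e yC.
Qed.

(** Allowing any fuel [f >= k] makes the induction hypothesis applicable to the smaller argument of
    the recursion. *)
Lemma min_vdeg_le_Nfuel (f k : nat) (F : clauseset) :
  (k <= f)%N -> is_clauseset F -> min_unsat F -> (ncl F <= nvar F + k)%N ->
  vars F != fset0 ->
  exists2 v, v \in vars F &
    [/\ (vdeg F v <= Nfuel f k)%N, (ld F (v, true) <= k)%N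
       & (ld F (v, false) <= k)%N].
Proof.
elim: f k F => [|f IH] k F le_kf cF muF le_k.
  (* Here [k = 0], which contradicts positive deficiency. *)
  by have := tarsi cF muF; lia.
have [G [[cG muG satG] [eqv eqc leld]]] := saturate cF muF.
move: le_k; rewrite /nvar -eqv -eqc -/(nvar G) => le_k.
move=> /exists_min_vdeg [v vG vmin].
have ldk b : (ld G (v, b) <= k)%N.
  by have := @min_vdeg_ld_le G (v, b) cG muG satG vG vmin; lia.
(* Degrees in [F] are at most those in [G], so bounds for [v] in [G] carry over. *)
exists v => //; split; try exact: leq_trans (leld _) (ldk _).
apply: (@leq_trans (vdeg G v)); first exact: leq_add.
have [b vb] : exists b, (vdeg G v <= 2 * ld G (v, b))%N.
  rewrite /vdeg; have [le_tf|lt_ft] := leqP (ld G (v, true)) (ld G (v, false)).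
    by exists false; rewrite mul2n -addnn leq_add2r.
  by exists true; rewrite mul2n -addnn leq_add2l ltnW.
set x := (v, b) in vb; have [ld1|ld2] := leqP (ld G x) 1.
  by apply: leq_trans (Nfuel_ge2 f.+1 k); lia.
apply: (@Nfuel_ge f k (ld G x)) => //; first by rewrite ld2 ldk.
have := ldk b; rewrite -/x => ldxk.
(* As [ld G x] is at least 2, this deficiency bound is below [k], hence within the remaining
   fuel. *)
have [|||||w wS [wN _ _]] := IH (k - ld G x + 1)%N (split G x).
- by lia.
- exact: split_is_clauseset.
- exact: split_min_unsat.
- by have := @split_deficiency G x cG muG vG vmin; lia.
- exact: split_vars_neq0.
move: wS; rewrite split_vars // !inE => /andP[wx wG].
apply: leq_trans (vmin w wG) _; apply: leq_trans (vdeg_le_split cG muG wx) _.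
by rewrite leq_add2r.
Qed.

Unset Implicit Arguments.

Theorem theorem8p3 (k : nat) (F : clauseset) :
  (0 < k)%N ->
  is_clauseset F ->
  min_unsat F ->
  (deficiency F <= k%:Z)%R ->
  F != [fset bot] ->
  exists2 v, v \in vars F &
    [/\ (vdeg F v <= Nnm k)%N, (ld F (v, true) <= k)%N & (ld F (v, false) <= k)%N].
Proof.
move=> k_gt0 cF muF; rewrite /deficiency => le_k Fbot.
apply: min_vdeg_le_Nfuel => //; first by lia.
by apply: contraNneq Fbot => v0; rewrite (vars0_eq_bot muF v0).
Qed.
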